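(* Let $(P,\mathcal S)$, $\mathcal S=\{S_1,\dots,S_m\}$, be a polygonal tree system associated with a convex polygon $P\subset\mathbb R^2$, and let $K$ be its attractor. Then (i) $\mathcal S$ satisfies the open set condition; (ii) $\mathcal S$ satisfies the one-point intersection property.
   Context: A polygon is understood as a compact region of the plane with nonempty interior. Let $P\subset\mathbb R^2$ be a convex polygon with vertices $A_1,\dots,A_n$, and let $\mathcal S=\{S_1,\dots,S_m\}$ be a finite system of contracting similarities of $\mathbb R^2$ (maps with $|S_i(x)-S_i(y)|=r_i|x-y|$ for all $x,y$, where $0<r_i<1$). Put $P_k=S_k(P)$. The system $(P,\mathcal S)$ is called a polygonal tree system associated with $P$ if: (D1) $P_k\subset P$ for all $k$; (D2) for $i\ne j$, $P_i\cap P_j$ is either empty or consists of exactly one point which is a common vertex of $P_i$ and $P_j$; (D3) for every vertex $A_k$ of $P$ there is an $i$ with $A_k\in P_i$; (D4) the set $\widetilde P=\bigcup_{i=1}^m P_i$ is contractible. The attractor of $\mathcal S$ is the unique nonempty compact set $K\subset\mathbb R^2$ with $K=\bigcup_{i=1}^m S_i(K)$. Open set condition: there is a nonempty open set $O\subset\mathbb R^2$ such that the sets $S_i(O)$, $1\le i\le m$, are pairwise disjoint and all contained in $O$. One-point intersection property: for any $i\neq j$, the set $S_i(K)\cap S_j(K)$ contains at most one point. *)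

(* Defs.v *)
From HB Require Import structures.
From mathcomp Require Import all_boot all_order all_algebra.
From mathcomp Require Import all_classical all_reals all_analysis.

Set Implicit Arguments.
Unset Strict Implicit.
Unset Printing Implicit Defensive.

Import Order.TTheory GRing.Theory Num.Theory.
Import numFieldNormedType.Exports.

Local Open Scope classical_set_scope.
Local Open Scope ring_scope.

Section Definitions.
Variable R : realType.

(* The plane R^2 is 'rV[R]_2. Its library norm is the sup norm, which induces
   the usual topology but not the metric needed for similarities. *)
Definition edist (x y : 'rV[R]_2) : R :=
  Num.sqrt (\sum_(i < 2) (x ord0 i - y ord0 i) ^+ 2).

Definition contracting_similarity (f : 'rV[R]_2 -> 'rV[R]_2) : Prop :=
  exists2 r : R, 0 < r < 1 & forall x y, edist (f x) (f y) = r * edist x y.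

Definition convex_hull (X : set 'rV[R]_2) : set 'rV[R]_2 :=
  smallest (fun C : set 'rV[R]_2 =>
              convex_set (C : set (convex_lmodType 'rV[R]_2))) X.

(* The last condition says that no A k is redundant, i.e. that the A k are
   pairwise distinct and are exactly the vertices (corners) of P. *)
Definition convex_polygon (n : nat) (P : set 'rV[R]_2)
    (A : 'I_n -> 'rV[R]_2) : Prop :=
  [/\ compact P, P° !=set0, P = convex_hull (range A) &
      forall k, ~ convex_hull (A @` [set l | l != k]) (A k)].

(* The homotopy H is only constrained on [0, 1] x X; a contractible set is in
   particular nonempty. *)
Definition contractible (X : set 'rV[R]_2) : Prop :=
  exists x0 : 'rV[R]_2, exists H : R * 'rV[R]_2 -> 'rV[R]_2,
    [/\ X x0,
        {within `[0, 1]%classic `*` X, continuous H},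
        forall t x, 0 <= t <= 1 -> X x -> X (H (t, x)),
        forall x, X x -> H (0, x) = x &
        forall x, X x -> H (1, x) = x0].

Section System.
Variables (n m : nat) (P : set 'rV[R]_2) (A : 'I_n -> 'rV[R]_2).
Variables (S : 'I_m -> 'rV[R]_2 -> 'rV[R]_2) (K : set 'rV[R]_2).

Record polygonal_tree_system : Prop := PolygonalTreeSystem {
  pts_polygon : convex_polygon P A ;
  pts_similarity : forall i, contracting_similarity (S i) ;
  pts_D1 : forall i, S i @` P `<=` P ;
  (* the vertices of S i @` P are the points S i (A k) *)
  pts_D2 : forall i j, i != j ->
    S i @` P `&` S j @` P = set0 \/
    exists x, [/\ S i @` P `&` S j @` P = [set x],
                  exists k, x = S i (A k) & exists l, x = S j (A l)] ;
  pts_D3 : forall k, exists i, (S i @` P) (A k) ;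
  pts_D4 : contractible (\bigcup_i (S i @` P))
}.

Definition attractor : Prop :=
  [/\ K !=set0, compact K & K = \bigcup_i (S i @` K)].

Definition open_set_condition : Prop :=
  exists O : set 'rV[R]_2,
    [/\ O !=set0, open O, trivIset setT (fun i => S i @` O) &
        forall i, S i @` O `<=` O].

Definition one_point_intersection : Prop :=
  forall i j, i != j -> is_subset1 (S i @` K `&` S j @` K).

End System.
End Definitions.

(* Main.v *)
Require Import Defs.
From mathcomp Require Import all_boot all_order all_algebra.
From mathcomp Require Import all_classical all_reals all_analysis.
From mathcomp Require Import ring lra.

Set Implicit Arguments.
Unset Strict Implicit.
Unset Printing Implicit Defensive.

Import Order.TTheory GRing.Theory Num.Theory.
Import numFieldNormedType.Exports.

Local Open Scope classical_set_scope.
Local Open Scope ring_scope.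

(** For the open set condition take the interior of P.  A similarity of the
    plane is onto, hence open, so each S i maps the interior of P onto an open
    subset of P, that is, into the interior.  Two distinct pieces S i (P) and
    S j (P) share at most one point, and a nonempty open set of the plane has
    more than one point, so the images of the interior are disjoint
    ([invariant_osc]).

    For the intersection property it is enough that K lies in P, since then
    S i (K) and S j (K) lie in pieces that share at most one point.  Each point
    of K is the image of a point of K under a composition of k maps, for every k.
    Such a composition keeps P inside P and shrinks distances by r ^ k, where
    r < 1 bounds all the ratios, so the point lies within a constant times r ^ k
    of P; as P is closed, the point is in P ([attractor_subset]). *)

(* The unqualified name also denotes the extended distance of a metric space. *)
Local Notation edist := Defs.edist.

Section Plane.
Variable R : realType.
Implicit Types (x y : 'rV[R]_2) (A : set 'rV[R]_2).

Lemma edistE x y : edist x y =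
  Num.sqrt ((x ord0 0 - y ord0 0) ^+ 2 + (x ord0 1 - y ord0 1) ^+ 2).
Proof.
rewrite /edist !big_ord_recl big_ord0 addr0.
by congr (Num.sqrt (_ + (x _ _ - y _ _) ^+ 2)); apply/val_inj.
Qed.

Lemma edist_sqr x y :
  edist x y ^+ 2 = (x ord0 0 - y ord0 0) ^+ 2 + (x ord0 1 - y ord0 1) ^+ 2.
Proof. by rewrite edistE sqr_sqrtr // addr_ge0 // sqr_ge0. Qed.

Lemma ord2_cases (j : 'I_2) : j = 0 \/ j = 1.
Proof. by case: j => [[|[|j]] hj] //; [left|right]; apply/val_inj. Qed.

Lemma coord_le_edist x y i j : `|x i j - y i j| <= edist x y.
Proof.
rewrite -sqrtr_sqr edistE ler_sqrt ?addr_ge0 ?sqr_ge0 //.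
by rewrite (ord1 i); case: (ord2_cases j) => ->; rewrite (lerDl, lerDr) sqr_ge0.
Qed.

Lemma edist_le_coord x y (e : R) :
  (forall i j, `|x i j - y i j| <= e) -> edist x y <= 2 * e.
Proof.
move=> h; have e0 : 0 <= e by apply: le_trans (h ord0 0).
rewrite -[leRHS]ger0_norm ?mulr_ge0 // -sqrtr_sqr edistE ler_sqrt ?sqr_ge0 //.
have sqle i j : (x i j - y i j) ^+ 2 <= e ^+ 2.
  by rewrite -real_normK ?num_real// ler_sqr ?nnegrE.
by have := sqle ord0 0; have := sqle ord0 1; have := sqr_ge0 e; nra.
Qed.

(** The topology of the plane comes from the sup norm, which is equivalent to the
    Euclidean one; with this, neighbourhoods can be moved by similarities. *)
Lemma nbhs_edist x A :
  nbhs x A <-> exists2 e : R, 0 < e & forall y, edist x y < e -> A y.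
Proof.
split.
  move=> /nbhs_ballP[e /= e0 he]; exists e => // y xy; apply: he; split=> // i j.
  exact: le_lt_trans (coord_le_edist _ _ _ _) xy.
move=> [e e0 he]; apply/nbhs_ballP; exists (e / 4) => /=; first lra.
move=> y [_ xy]; apply: he; apply: (@le_lt_trans _ _ (2 * (e / 4))); last lra.
by apply: edist_le_coord => i j; apply/ltW/xy.
Qed.

Lemma compact_edist_bounded A x :
  compact A -> exists M, forall y, A y -> edist y x <= M.
Proof.
move=> /compact_bounded[M [_ hM]].
have {}hM := hM (M + 1) (ltr_pwDr ltr01 (lexx _)).
have entry_le (z : 'rV[R]_2) i j : `|z i j| <= `|z|.
  by rewrite [leRHS]mx_normrE (le_bigmax _ (fun p : 'I_1 * 'I_2 => `|z p.1 p.2|) (i, j)).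
exists (2 * (M + 1 + `|x|)) => y Ay; apply: edist_le_coord => i j.
rewrite (le_trans (ler_normB _ _))// lerD//.
exact: le_trans (entry_le _ _ _) (hM _ Ay).
Qed.

Section Similarity.
Variables (f : 'rV[R]_2 -> 'rV[R]_2) (r : R).
Hypotheses (r0 : 0 < r) (fr : forall x y, edist (f x) (f y) = r * edist x y).

Let dot x y : R := x ord0 0 * y ord0 0 + x ord0 1 * y ord0 1.

(** Polarization: a map that scales distances also scales inner products, once
    the image of the origin is moved back to the origin. *)
Lemma similarity_dot x y : dot (f x - f 0) (f y - f 0) = r ^+ 2 * dot x y.
Proof.
have q u v : edist (f u) (f v) ^+ 2 = r ^+ 2 * edist u v ^+ 2.
  by rewrite fr exprMn.
have := q x y; have := q x 0; have := q y 0.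
rewrite !edist_sqr /dot !mxE; nra.
Qed.

(** The images a and b of the unit vectors, seen from [f 0], are orthogonal of
    length r, so they form a basis of the plane.  The preimage of y is the point
    whose coordinates are those of [y - f 0] in this basis: its image and y have
    the same inner products with a and b, and Cramer's rule says that they are
    then equal. *)
Lemma similarity_surjective y : exists x, f x = y.
Proof.
pose e1 : 'rV[R]_2 := delta_mx ord0 0; pose e2 : 'rV[R]_2 := delta_mx ord0 1.
pose a := f e1 - f 0; pose b := f e2 - f 0; pose v := y - f 0.
pose x : 'rV[R]_2 :=
  \row_j (if j == 0 then dot v a / r ^+ 2 else dot v b / r ^+ 2).
exists x.
have r2 : r ^+ 2 != 0 by rewrite expf_neq0 // gt_eqF.
have d1 z : dot z e1 = z ord0 0 by rewrite /dot !mxE /= mulr1 mulr0 addr0.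
have d2 z : dot z e2 = z ord0 1 by rewrite /dot !mxE /= mulr1 mulr0 add0r.
have wa : dot (f x - f 0) a = dot v a.
  by rewrite similarity_dot d1 mxE /= mulrC divfK.
have wb : dot (f x - f 0) b = dot v b.
  by rewrite similarity_dot d2 mxE /= mulrC divfK.
have aa : dot a a = r ^+ 2 by rewrite similarity_dot d1 mxE /= mulr1.
have bb : dot b b = r ^+ 2 by rewrite similarity_dot d2 mxE /= mulr1.
have ab : dot a b = 0 by rewrite similarity_dot d2 mxE /= mulr0.
pose D := a ord0 0 * b ord0 1 - a ord0 1 * b ord0 0.
(* The Gram determinant of a and b is the square of their determinant. *)
have D2 : D ^+ 2 = r ^+ 2 * r ^+ 2.
  have -> : D ^+ 2 = dot a a * dot b b - dot a b ^+ 2 by rewrite /D /dot; ring.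
  by rewrite aa bb ab expr0n subr0.
have D0 : D != 0 by rewrite -sqrf_eq0 D2 mulf_neq0.
have cramer0 (z : 'rV[R]_2) : z ord0 0 * D = dot z a * b ord0 1 - dot z b * a ord0 1.
  by rewrite /dot /D; ring.
have cramer1 (z : 'rV[R]_2) : z ord0 1 * D = dot z b * a ord0 0 - dot z a * b ord0 0.
  by rewrite /dot /D; ring.
suff vE : f x - f 0 = v by rewrite -[f x](subrK (f 0)) vE subrK.
apply/rowP => j; apply: (mulIf D0).
by case: (ord2_cases j) => ->; rewrite ?cramer0 ?cramer1 wa wb.
Qed.

(** By surjectivity the image of the Euclidean ball of radius e about x is the
    whole ball of radius [r * e] about [f x]. *)
Lemma similarity_open A : open A -> open (f @` A).
Proof.
move=> oA; rewrite openE => _ [x Ax <-].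
have /nbhs_edist[e e0 he] : nbhs x A by apply: open_nbhs_nbhs.
apply/nbhs_edist; exists (r * e); first exact: mulr_gt0.
move=> y; have [z <-] := similarity_surjective y.
by rewrite fr ltr_pM2l // => xz; exists z => //; apply: he.
Qed.

End Similarity.

Lemma open_subset1_empty A : open A -> is_subset1 A -> A = set0.
Proof.
move=> oA A1; rewrite -subset0 => x Ax.
have /nbhs_ballP[e /= e0 he] : nbhs x A by apply: open_nbhs_nbhs.
have /(A1 _ _ Ax)/rowP/(_ 0) : A (x + const_mx (e / 2)).
  apply: he; split=> // i j.
  by rewrite !mxE -ball_normE /= opprD addNKr normrN gtr0_norm; lra.
by rewrite !mxE; lra.
Qed.

Section Systems.
Variables (m : nat) (S : 'I_m -> 'rV[R]_2 -> 'rV[R]_2).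
Hypothesis Ssim : forall i, contracting_similarity (S i).

Lemma common_ratio : exists2 r : R, 0 <= r < 1 &
  forall i x y, edist (S i x) (S i y) <= r * edist x y.
Proof.
have /choice[r hr] : forall i, exists r : R, 0 < r < 1 /\
  forall x y, edist (S i x) (S i y) = r * edist x y.
  by move=> i; have [r] := Ssim i; exists r.
(* Starting the maximum at 0 also serves the empty system. *)
exists (\big[Order.max/0]_i r i).
  rewrite bigmax_ge_id /=; apply/bigmax_ltP; split => // i _.
  by have [/andP[]] := hr i.
move=> i x y; have [_ ->] := hr i.
by rewrite ler_wpM2r ?sqrtr_ge0 //; apply: le_bigmax.
Qed.

(** By induction on k, a point of K is within [r ^+ k * M] of P, where M bounds
    the distance from K to some point of P: write the point as [S i z] with z in
    K and apply [S i] to a point of P close to z. *)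
Lemma attractor_subset (K P : set 'rV[R]_2) : attractor S K ->
  P !=set0 -> closed P -> (forall i, S i @` P `<=` P) -> K `<=` P.
Proof.
move=> [_ cK KE] [p Pp] clP SP x Kx; apply: clP.
have [r /andP[r0 r1] hr] := common_ratio.
have [M hM] := compact_edist_bounded p cK.
have near_P k y : K y -> exists2 q, P q & edist y q <= r ^+ k * M.
  elim: k y => [|k IH] y; first by move=> Ky; exists p; rewrite // mul1r hM.
  rewrite {1}KE => -[i _ [z Kz <-]]; have [q Pq zq] := IH z Kz.
  exists (S i q); first by apply: (SP i); exists q.
  by rewrite (le_trans (hr _ _ _))// exprS -mulrA ler_wpM2l.
move=> B /nbhs_edist[e e0 he].
have rk0 : (fun k => r ^+ k * M) @ \oo --> (0 : R).
  rewrite -(mul0r M); apply: cvgMr_tmp; apply: cvg_expr; rewrite ger0_norm //.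
have /cvgr_lt/(_ e e0)[k _ /(_ k (leqnn k)) /= hk] := rk0.
have [q Pq xq] := near_P k x Kx.
by exists q; split => //; apply: he; apply: le_lt_trans hk.
Qed.

Lemma invariant_osc (P : set 'rV[R]_2) : P° !=set0 ->
  (forall i, S i @` P `<=` P) ->
  (forall i j, i != j -> is_subset1 (S i @` P `&` S j @` P)) ->
  open_set_condition S.
Proof.
move=> P0 SP PP; exists P°.
have oSP i : open (S i @` P°).
  have [r /andP[r0 _] hr] := Ssim i.
  by apply: (similarity_open r0 hr); exact: open_interior.
have sub i : S i @` P° `<=` S i @` P by apply: image_subset; exact: interior_subset.
split => //; first exact: open_interior.
  move=> i j _ _ [z [zi zj]]; apply/eqP/negPn/negP => ij.
  have : (S i @` P° `&` S j @` P°) z by [].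
  rewrite (open_subset1_empty (openI (oSP i) (oSP j))) //.
  by move=> u v [ui uj] [vi vj]; apply: (PP _ _ ij); split; apply: sub.
by move=> i; rewrite -open_subsetE // => u /sub; exact: SP.
Qed.

End Systems.
End Plane.

Theorem proposition10 (R : realType) (n m : nat)
    (P : set 'rV[R]_2) (A : 'I_n -> 'rV[R]_2)
    (S : 'I_m -> 'rV[R]_2 -> 'rV[R]_2) (K : set 'rV[R]_2)
    (hS : polygonal_tree_system P A S) (hK : attractor S K) :
  open_set_condition S /\ one_point_intersection S K.
Proof.
have [[cP P0 _ _] Ssim SP D2 _ _] := hS.
have PP i j : i != j -> is_subset1 (S i @` P `&` S j @` P).
  move=> /D2[->|[x [-> _ _]]]; first by move=> ? ?.
  by move=> u v -> ->.
split; first exact: invariant_osc P0 SP PP.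
have KP : K `<=` P.
  apply: (attractor_subset Ssim hK) => //.
    by have [x /interior_subset Px] := P0; exists x.
  exact: compact_closed (@norm_hausdorff _ _) cP.
move=> i j ij u v [ui uj] [vi vj]; apply: (PP _ _ ij).
  by split; apply: image_subset KP _ _.
by split; apply: image_subset KP _ _.
Qed.
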